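(* Let $p$ be a prime number and $n > 1$ an integer. Then the set of all solutions $(x,y,z)$ in non-negative integers of the Diophantine equation $$p^x + p^y = z^{2n}$$ is exactly the following: - if $p = 2$: the triples $(2s+1,\, 2s+1,\, 2^{(s+1)/n})$, where $s$ ranges over all non-negative integers with $s+1 \equiv 0 \pmod n$; - if $p \geq 3$: there are no solutions. *)

(* Defs.v *)
From mathcomp Require Import all_boot.

(* Main.v *)
(** For [x < y] the equation forces [1 + p ^ (y - x) = w ^ (2 * n)], where [w] is
    the part of [z] prime to [p]. Then [w ^ n - 1] and [w ^ n + 1] are powers of
    [p] differing by 2, so [w ^ n] is 2 or 3, which is impossible for [n > 1]. For
    [x = y] the equation is [2 * p ^ x = z ^ (2 * n)], settled by the 2-adic
    valuation when [p] is odd. *)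
Require Import Defs.
From mathcomp Require Import all_boot.
From mathcomp Require Import zify.

Lemma succ_pfactor_neq_exp (p n d w : nat) :
  prime p -> 1 < n -> 1 + p ^ d <> w ^ (2 * n).
Proof.
move=> hp hn E.
have pd_gt0 : 0 < p ^ d by rewrite expn_gt0 prime_gt0.
have w_gt1 : 1 < w.
  case: w E => [|[|w]] //; first by rewrite exp0n; lia.
  by rewrite exp1n; lia.
(* Here [1 < n] rules out [w ^ n] being 2 or 3, so [w ^ n - 1] is at least 3. *)
have wn_ge4 : 4 <= w ^ n.
  apply: (@leq_trans (2 ^ n)); first by rewrite (@leq_exp2l 2 2 n).
  by rewrite leq_exp2r; lia.
have F : p ^ d = (w ^ n - 1) * (w ^ n + 1).
  have := subn_sqr (w ^ n) 1.
  by rewrite exp1n -expnM mulnC -E addKn.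
have [a _ Ha] : exists2 a, a <= d & w ^ n - 1 = p ^ a.
  by apply/dvdn_pfactor; rewrite // F dvdn_mulr.
have [b _ Hb] : exists2 b, b <= d & w ^ n + 1 = p ^ b.
  by apply/dvdn_pfactor; rewrite // F dvdn_mull.
have leab : a <= b by rewrite -(leq_exp2l _ _ (prime_gt1 hp)); lia.
(* [p ^ a] divides both itself and [p ^ b = p ^ a + 2], hence their difference. *)
have : p ^ a %| 2.
  by rewrite -(@dvdn_addr (p ^ a)) // (_ : p ^ a + 2 = p ^ b) ?dvdn_exp2l //; lia.
by move=> /(dvdn_leq (ltn0Sn 1)); lia.
Qed.

(** Comparing [p]-adic valuations gives [x = logn p z * (2 * n)], so [p ^ x] cancels and the
    previous lemma applies. *)
Lemma add_pfactor_neq_exp (p n x y z : nat) :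
  prime p -> 1 < n -> x < y -> p ^ x + p ^ y <> z ^ (2 * n).
Proof.
move=> hp hn ltxy E.
have p_gt0 := prime_gt0 hp.
have z_gt0 : 0 < z.
  case: z E => // /eqP.
  by rewrite exp0n ?addn_eq0 ?expn_eq0; lia.
have [w copw Ez] := pfactor_coprime hp z_gt0.
have {}E : p ^ x * (1 + p ^ (y - x)) = w ^ (2 * n) * p ^ (logn p z * (2 * n)).
  by rewrite [p ^ (_ * (2 * n))]expnM -expnMn -Ez -E mulnDr muln1 -expnD subnKC // ltnW.
have Ex : x = logn p z * (2 * n).
  have := congr1 (logn p) E.
  have cop1 : coprime p (1 + p ^ (y - x)).
    (* The positive exponent makes the cofactor congruent to 1 modulo [p]. *)
    have [d ->] : exists d, y - x = d.+1 by exists (y - x).-1; lia.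
    by rewrite expnS mulnC addnC /coprime gcdnMDl gcdn1.
  have copwn : coprime p (w ^ (2 * n)) by apply: coprimeXr.
  by rewrite mulnC !logn_Gauss // !pfactorK.
apply: (@succ_pfactor_neq_exp p n (y - x) w) => //.
apply/eqP; rewrite -(@eqn_pmul2l (p ^ x)) ?expn_gt0 ?p_gt0 //.
by rewrite E -Ex mulnC.
Qed.

Theorem theorem3p3 (p n : nat) (hp : prime p) (hn : 1 < n) :
  (p = 2 ->
     forall x y z : nat,
       p ^ x + p ^ y = z ^ (2 * n) <->
       exists s : nat,
         s + 1 = 0 %[mod n] /\
         (x, y, z) = (2 * s + 1, 2 * s + 1, 2 ^ ((s + 1) %/ n))) /\
  (3 <= p ->
     forall x y z : nat, p ^ x + p ^ y <> z ^ (2 * n)).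
Proof.
have eq_xy x y z : p ^ x + p ^ y = z ^ (2 * n) -> x = y.
  by case: (ltngtP x y) => // lt E; case: (@add_pfactor_neq_exp _ _ _ _ z hp hn lt);
    rewrite // addnC.
split=> [Ep x y z | p_ge3 x y z E].
- split=> [E | [s [Hs [-> -> ->]]]].
  + have Exy := eq_xy _ _ _ E; subst y p.
    rewrite addnn -mul2n -expnS in E.
    have [k _ Ez] : exists2 k, k <= x.+1 & z = 2 ^ k.
      by apply/dvdn_pfactor; rewrite // E dvdn_exp //; lia.
    have Ex : x.+1 = 2 * (k * n).
      by apply/eqP; rewrite -(@eqn_exp2l 2) // E Ez -expnM mulnCA.
    have kn_gt0 : 0 < k * n by lia.
    (* From [x + 1 = 2 * (k * n)] and [x = 2 * s + 1] comes [s + 1 = k * n]. *)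
    exists (k * n).-1; rewrite addn1 prednK // mulnK; last by lia.
    split; first by rewrite modnMl mod0n.
    by rewrite Ez; congr (_, _, _); lia.
  + have dvd_n : n %| s + 1 by rewrite /dvdn Hs mod0n.
    rewrite Ep addnn -mul2n -expnS -expnM mulnCA divnK //.
    by congr (_ ^ _); lia.
- have Exy := eq_xy _ _ _ E; subst y.
  (* The left side has 2-adic valuation 1 as [p] is odd; the right side has an even one. *)
  have := congr1 (logn 2) E.
  have cop2p : coprime 2 (p ^ x).
    by rewrite coprimeXr // prime_coprime // dvdn_prime2 //; lia.
  rewrite addnn -muln2 logn_Gauss // lognX logn_prime //=.
  by move: (logn 2 z); nia.
Qed.
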